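(* Let $0<q<1$. For all real numbers $A,t,s>0$ one has $$K(A;t)\int_0^{\infty/A(1-q)}x^{t-1}e_q^{-x}\,d_qx=\Gamma_q(t)$$ and $$K(A;t)\int_0^{\infty/A}\frac{x^{t-1}}{(1+x)_q^{t+s}}\,d_qx=\mathrm{B}_q(t,s).$$
   Context: Fix $0<q<1$. Notation: $(1+a)_q^\infty=\prod_{j=0}^\infty(1+q^ja)$ and, for $t\in\mathbb C$, $(1+a)_q^t=\dfrac{(1+a)_q^\infty}{(1+q^ta)_q^\infty}$; expressions such as $(1-qx)_q^{s-1}$ and $(1+1/x)_q^t$ are obtained by substituting for $a$. The two $q$-exponential functions are $E_q^x=(1+(1-q)x)_q^\infty$ and $e_q^x=\dfrac{1}{(1-(1-q)x)_q^\infty}$ (so $e_q^{-x}=1/(1+(1-q)x)_q^\infty$). Jackson integrals: for $a>0$, $\int_0^a f(x)\,d_qx=(1-q)\sum_{n\ge 0}q^na\,f(q^na)$. Improper Jackson integral: for $C>0$, $\int_0^{\infty/C}f(x)\,d_qx=(1-q)\sum_{n\in\mathbb Z}\frac{q^n}{C}f\big(\frac{q^n}{C}\big)$. Here $\infty/A(1-q)$ means $\infty/C$ with $C=A(1-q)$. The $q$-gamma and $q$-beta functions are defined for $t,s>0$ by $$\Gamma_q(t)=\int_0^{1/(1-q)}x^{t-1}E_q^{-qx}\,d_qx,\qquad \mathrm{B}_q(t,s)=\int_0^1x^{t-1}(1-qx)_q^{s-1}\,d_qx.$$ The function $K$ (which also depends on $q$) is, for $x>0$ and $t\in\mathbb R$,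 $$K(x;t)=\frac{x^t}{1+x}\Big(1+\frac1x\Big)_q^t(1+x)_q^{1-t}.$$ *)

(* Defs.v *)
From HB Require Import structures.
From mathcomp Require Import all_boot all_order all_algebra.
From mathcomp Require Import all_classical all_reals all_analysis.

Set Implicit Arguments.
Unset Strict Implicit.
Unset Printing Implicit Defensive.

Import Order.TTheory GRing.Theory Num.Theory.
Import numFieldNormedType.Exports.

Local Open Scope ring_scope.

(* (1 + a)_q^oo.  For 0 < q < 1 the partial products converge for every a, so
   limn is the genuine limit. *)
Definition qpow_infty {R : realType} (q a : R) : R :=
  limn (fun n : nat => \prod_(0 <= j < n) (1 + q ^+ j * a)).

(* (1 + a)_q^t, for real t; powR (notation x `^ t) is the real power of a
   positive base. *)
Definition qpow {R : realType} (q a t : R) : R :=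
  qpow_infty q a / qpow_infty q (q `^ t * a).

(* The q-exponentials E_q^x and e_q^x. *)
Definition Eq_exp {R : realType} (q x : R) : R := qpow_infty q ((1 - q) * x).

Definition eq_exp {R : realType} (q x : R) : R :=
  (qpow_infty q (- ((1 - q) * x)))^-1.

(* Two-sided sums over Z: Posz n is n and Negz n is - (n + 1), so every integer
   is counted once. Convergence means that both halves converge. *)
Definition bisum {R : realType} (u : int -> R) : R :=
  limn (series (fun n : nat => u (Posz n))) +
  limn (series (fun n : nat => u (Negz n))).

Definition bisum_cvg {R : realType} (u : int -> R) : Prop :=
  cvgn (series (fun n : nat => u (Posz n))) /\
  cvgn (series (fun n : nat => u (Negz n))).

(* \int_0^a f(x) d_q x *)
Definition jackson {R : realType} (q : R) (f : R -> R) (a : R) : R :=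
  (1 - q) * limn (series (fun n : nat => q ^+ n * a * f (q ^+ n * a))).

(* \int_0^(oo/C) f(x) d_q x; the exponent n ranges over Z. *)
Definition jackson_improper_term {R : realType} (q : R) (f : R -> R) (C : R)
    (n : int) : R :=
  q ^ n / C * f (q ^ n / C).

Definition jackson_improper {R : realType} (q : R) (f : R -> R) (C : R) : R :=
  (1 - q) * bisum (jackson_improper_term q f C).

Definition jackson_improper_cvg {R : realType} (q : R) (f : R -> R) (C : R)
    : Prop :=
  bisum_cvg (jackson_improper_term q f C).

Definition qGamma {R : realType} (q t : R) : R :=
  jackson q (fun x => x `^ (t - 1) * Eq_exp q (- (q * x))) (1 - q)^-1.

Definition qBeta {R : realType} (q t s : R) : R :=
  jackson q (fun x => x `^ (t - 1) * qpow q (- (q * x)) (s - 1)) 1.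

Definition qK {R : realType} (q x t : R) : R :=
  x `^ t / (1 + x) * qpow q x^-1 t * qpow q x (1 - t).

(* Main.v *)
(* Write P(x) = (1 + x)_q^oo, z = q^t, c = 1/A and, for suitable b and c,
   F(b) = sum_{n in Z} z^n P(q^n b) / P(q^n c),
   S(c) = sum_{n >= 0} z^n P(-q^(n+1)) / P(q^n c).
   Up to powers of A and 1 - q, the improper integrals are F(0) and F(q^(t+s) c),
   while Gamma_q(t) and B_q(t,s) are S(0) and S(-q^s).  As in the Andrews-Askey proof
   of Ramanujan's 1psi1 summation, the shift n -> n + 1 yields
   (1 - b/(zc)) F(b) = (1 - b/c) F(qb), and likewise (1 + c) S(c) = (1 + zc) S(qc).
   Iterating, P(-b/(zc)) F(b) = P(-b/c) F(0) and P(c) S(c) = P(zc) S(0).  For b = -q the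
   terms of negative index vanish, so F(-q) = S(c), which links F(0) to S(0); the factor
   that appears is K(A;t) = A^t P(c) P(q/c) / (P(zc) P(q/(zc))). *)
Require Import Defs.
From HB Require Import structures.
From mathcomp Require Import all_boot all_order all_algebra.
From mathcomp Require Import all_classical all_reals all_analysis.
From mathcomp Require Import ring lra zify.

Set Implicit Arguments.
Unset Strict Implicit.
Unset Printing Implicit Defensive.

Import Order.TTheory GRing.Theory Num.Theory.
Import numFieldNormedType.Exports.

Local Open Scope classical_set_scope.
Local Open Scope ring_scope.

(** * Infinite products: convergence, sign, monotonicity and behaviour near 0 *)

Lemma qprod_recl (R : realType) (q a : R) (n : nat) :
  \prod_(0 <= j < n.+1) (1 + q ^+ j * a) =
  (1 + a) * \prod_(0 <= j < n) (1 + q ^+ j * (q * a)).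
Proof.
rewrite big_nat_recl// expr0 mul1r; congr (_ * _).
by apply: eq_bigr => j _; rewrite exprSr mulrA.
Qed.

Lemma qprod_ge0 (R : realType) (q a : R) (n : nat) : 0 <= q -> 0 <= a ->
  0 <= \prod_(0 <= j < n) (1 + q ^+ j * a).
Proof.
by move=> q0 a0; apply: prodr_ge0 => j _; rewrite addr_ge0// mulr_ge0 ?exprn_ge0.
Qed.

(** Induction on [n] with [a] replaced by [q * a]: the first factor satisfies 1 + a <= exp a, and
    the exponents add up because a + q a / (1 - q) = a / (1 - q). *)
Lemma qprod_le_expR (R : realType) (q a : R) (n : nat) : 0 < q -> q < 1 -> 0 <= a ->
  \prod_(0 <= j < n) (1 + q ^+ j * a) <= expR (a / (1 - q)).
Proof.
move=> q0 q1 a0.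
elim: n a a0 => [|n IH] a a0.
  by rewrite big_geq// (le_trans _ (expR_ge1Dx _))// lerDl divr_ge0// subr_ge0 ltW.
rewrite qprod_recl; have qa0 : 0 <= q * a by rewrite mulr_ge0// ltW.
have -> : a / (1 - q) = a + q * a / (1 - q) by field; lra.
by rewrite expRD ler_pM ?qprod_ge0 ?expR_ge1Dx ?addr_ge0 ?IH// ltW.
Qed.

Lemma is_cvg_qprod_shift (R : realType) (q a : R) :
  cvgn (fun n : nat => \prod_(0 <= j < n) (1 + q ^+ j * (q * a))) ->
  cvgn (fun n : nat => \prod_(0 <= j < n) (1 + q ^+ j * a)).
Proof.
move=> /cvg_ex[l ql]; apply/cvg_ex; exists ((1 + a) * l).
rewrite -cvg_shiftS /=.
under eq_fun do rewrite qprod_recl.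
exact: cvgMl_tmp.
Qed.

Lemma exists_small_geometric (R : realType) (q a e : R) : 0 < q -> q < 1 -> 0 < e ->
  exists m : nat, `|q ^+ m * a| < e.
Proof.
move=> q0 q1 e0.
have q_cvg0 : (q ^+ m * a) @[m --> \oo] --> (0 : R).
  rewrite -[X in _ --> X](mul0r a); apply: cvgMr_tmp; apply: cvg_expr.
  by rewrite ger0_norm ?ltW.
have /cvgr0Pnorm_lt/(_ e e0)[m _ me] := q_cvg0.
by exists m; apply: me => /=.
Qed.

(** Factors may be negative when [a] is very negative, so finitely many are split off until |q^m a|
    < 1. All factors are then nonnegative and the partial products are monotone: increasing and
    bounded by an exponential for a >= 0, decreasing and bounded by 0 for a < 0. *)
Lemma qprod_cvg (R : realType) (q a : R) : 0 < q -> q < 1 ->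
  (fun n : nat => \prod_(0 <= j < n) (1 + q ^+ j * a)) @ \oo --> qpow_infty q a.
Proof.
move=> q0 q1; rewrite /qpow_infty.
have [m am] := exists_small_geometric a q0 q1 (@ltr01 R).
elim: m a am => [|m IH] a.
  rewrite expr0 mul1r => am.
  have qj1 j : q ^+ j <= 1 by rewrite exprn_ile1 ?ltW.
  have qj0 j : 0 < q ^+ j by rewrite exprn_gt0.
  have f0 j : 0 <= 1 + q ^+ j * a.
    have := qj1 j; have := qj0 j; move: am; rewrite ltr_norml => /andP[? ?] *; nra.
  have [a0|a0] := leP 0 a.
    apply: nondecreasing_is_cvgn.
      apply/nondecreasing_seqP => n; rewrite big_nat_recr//= ler_peMr ?prodr_ge0//.
      by rewrite lerDl mulr_ge0// ltW.
    by exists (expR (a / (1 - q))) => _ [n _ <-]; exact: qprod_le_expR.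
  apply: nonincreasing_is_cvgn.
    apply/nonincreasing_seqP => n; rewrite big_nat_recr//= ler_piMr ?prodr_ge0//.
    by rewrite gerDl pmulr_rle0// ltW.
  by exists 0 => _ [n _ <-]; exact: prodr_ge0.
rewrite exprSr -mulrA => am.
by apply: is_cvg_qprod_shift; exact: IH.
Qed.

Lemma qpow_inftyS (R : realType) (q a : R) : 0 < q -> q < 1 ->
  qpow_infty q a = (1 + a) * qpow_infty q (q * a).
Proof.
move=> q0 q1; rewrite {1}/qpow_infty; apply: cvg_lim => //.
rewrite -cvg_shiftS /=.
under eq_fun do rewrite qprod_recl.
by apply: cvgMl_tmp; exact: qprod_cvg.
Qed.

Lemma qpow_infty_split (R : realType) (q a : R) (n : nat) : 0 < q -> q < 1 ->
  qpow_infty q a = \prod_(0 <= j < n) (1 + q ^+ j * a) * qpow_infty q (q ^+ n * a).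
Proof.
move=> q0 q1; elim: n a => [|n IH] a; first by rewrite big_geq// expr0 !mul1r.
by rewrite qpow_inftyS// IH qprod_recl exprSr !mulrA.
Qed.

Lemma qpow_infty_ge1 (R : realType) (q a : R) : 0 < q -> q < 1 -> 0 <= a ->
  1 <= qpow_infty q a.
Proof.
move=> q0 q1 a0; apply: limr_ge; first exact/cvgP/qprod_cvg.
near=> n; elim/big_ind: _ => //; first exact: mulr_ege1.
by move=> j _; rewrite lerDl mulr_ge0// exprn_ge0// ltW.
Unshelve. all: by end_near. Qed.

Lemma qpow_infty_gt0 (R : realType) (q a : R) : 0 < q -> q < 1 -> -1 < a ->
  0 < qpow_infty q a.
Proof.
move=> q0 q1 a1; have [a0|a0] := leP 0 a.
  by rewrite (lt_le_trans ltr01)// qpow_infty_ge1.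
have qj1 j : q ^+ j <= 1 by rewrite exprn_ile1 ?ltW.
have qj0 j : 0 < q ^+ j by rewrite exprn_gt0.
have f0 j : 0 <= 1 + q ^+ j * a by have := qj1 j; have := qj0 j; nra.
have P0 : 0 <= qpow_infty q a.
  apply: limr_ge; first exact/cvgP/qprod_cvg.
  by near=> n; exact: prodr_ge0.
(* For x = -a, (1 - q^j x) (1 + q^j x / (1 - x)) >= 1 since q^j <= 1, which bounds
   the product away from 0. *)
suff : 1 <= qpow_infty q a * qpow_infty q (- a / (1 + a)).
  move=> PP; rewrite lt_neqAle P0 andbT eq_sym; apply: contraTneq PP => ->.
  by rewrite mul0r -ltNge.
have /(_ eventually_filter) cM := cvgM (@qprod_cvg _ _ a q0 q1)
  (@qprod_cvg _ _ (- a / (1 + a)) q0 q1).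
rewrite -(cvg_lim _ cM)//; apply: limr_ge; first exact/cvgP/cM.
near=> n; rewrite /= -big_split/=.
elim/big_ind: _ => //; first exact: mulr_ege1.
move=> j _; have := qj1 j; have := qj0 j; move: (q ^+ j) => x x0 x1.
have -> : (1 + x * a) * (1 + x * (- a / (1 + a))) = 1 + x * (1 - x) * a ^+ 2 / (1 + a).
  by field; lra.
rewrite lerDl divr_ge0//; last lra.
by rewrite mulr_ge0 ?sqr_ge0// mulr_ge0 ?subr_ge0 ?(ltW x0)//.
Unshelve. all: by end_near. Qed.

Lemma qpow_infty_ge0 (R : realType) (q a : R) : 0 < q -> q < 1 -> -1 <= a ->
  0 <= qpow_infty q a.
Proof.
move=> q0 q1; rewrite le_eqVlt => /predU1P[<-|a1]; last exact/ltW/qpow_infty_gt0.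
by rewrite qpow_inftyS// subrr mul0r.
Qed.

Lemma qpow_infty0 (R : realType) (q : R) : qpow_infty q 0 = 1.
Proof.
rewrite /qpow_infty (_ : (fun n => _) = fun=> 1) ?lim_cst//.
by apply/funext => n; rewrite big1// => j _; rewrite mulr0 addr0.
Qed.

Lemma ler_qpow_infty (R : realType) (q a b : R) : 0 < q -> q < 1 -> -1 <= a -> a <= b ->
  qpow_infty q a <= qpow_infty q b.
Proof.
move=> q0 q1 a1 ab; apply: ler_lim; [exact/cvgP/qprod_cvg|exact/cvgP/qprod_cvg|].
near=> n; apply: ler_prod => j _.
have : q ^+ j <= 1 by rewrite exprn_ile1 ?ltW.
have : 0 < q ^+ j by rewrite exprn_gt0.
by move=> ? ?; apply/andP; split; nra.
Unshelve. all: by end_near. Qed.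

(** After a shift of [N] the argument is q^N y with y > -1, so P(y) > 0. Then P(q^N y) is P(y)
    divided by its N-th partial product, which tends to P(y) / P(y). This supplies the termwise
    limits when the recurrences are iterated. *)
Lemma qpow_infty_cvg1 (R : realType) (q x : R) : 0 < q -> q < 1 ->
  qpow_infty q (q ^+ N * x) @[N --> \oo] --> (1 : R).
Proof.
move=> q0 q1; have [m] := exists_small_geometric x q0 q1 (@ltr01 R).
rewrite ltr_norml => /andP[xm _].
rewrite -(cvg_shiftn m) /=.
under eq_fun do rewrite exprD -mulrA.
move: (q ^+ m * x) xm => y y1; have Py := qpow_infty_gt0 q0 q1 y1.
have lim1 : (qpow_infty q y / \prod_(0 <= j < N) (1 + q ^+ j * y)) @[N --> \oo] --> (1 : R).
  rewrite -[X in _ --> X](@divff _ (qpow_infty q y)) ?gt_eqF//.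
  by have /(_ eventually_filter)/cvgMl_tmp := cvgV (lt0r_neq0 Py) (@qprod_cvg _ _ y q0 q1); exact.
apply: cvg_trans lim1; apply: near_eq_cvg; near=> N => /=.
rewrite {1}(qpow_infty_split y N)// mulrC mulrA mulVf ?mul1r//.
apply: contraTneq Py => P0.
by rewrite (qpow_infty_split y N)// P0 mul0r ltxx.
Unshelve. all: by end_near. Qed.

(** * Dominated convergence, linearity and shifts for sums over the naturals and the integers *)

Lemma series_dominated_is_cvg (R : realType) (u M : R ^nat) :
  (forall n, `|u n| <= M n) -> cvgn (series M) -> cvgn (series u).
Proof.
move=> uM cM; apply: normed_cvg; apply: (series_le_cvg _ _ uM cM) => // n.
exact: le_trans (normr_ge0 _) (uM n).
Qed.

(** Tannery's theorem. Cut at an [m] beyond which [M] has tail at most e/3. The finite head of the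
    differences tends to 0, and the rest is at most twice the tail of [M] because [v] inherits the
    bound [M]. *)
Lemma series_dominated_cvg (R : realType) (u : nat -> R ^nat) (v M : R ^nat) :
  (forall N n, `|u N n| <= M n) -> cvgn (series M) ->
  (forall n, u N n @[N --> \oo] --> v n) ->
  limn (series (u N)) @[N --> \oo] --> limn (series v).
Proof.
move=> uM cM uv.
have M0 n : 0 <= M n by rewrite (le_trans (normr_ge0 _) (uM 0%N n)).
have vM n : `|v n| <= M n.
  rewrite -(cvg_lim (@Rhausdorff R) (cvg_norm (uv n))).
  by apply: limr_le; [exact: is_cvg_norm (cvgP _ (uv n))|near=> N; exact: uM].
apply/cvgrPdist_le => e e0.
have e3 : 0 < e / 3 by rewrite divr_gt0.
have [m _ mtail] := (cvgrPdist_le _ _).1 cM _ e3.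
have {}mtail : limn (series M) - series M m <= e / 3.
  by rewrite (le_trans (ler_norm _))// mtail /=.
have headN : (\sum_(0 <= n < m) `|v n - u N n|) @[N --> \oo] --> (0 : R).
  rewrite -[X in _ --> X](_ : \sum_(0 <= n < m) `|v n - v n| = 0); last first.
    by rewrite big1// => n _; rewrite subrr normr0.
  apply: cvg_big => [|n _]; first exact: add_continuous.
  apply: cvg_norm; apply: cvgB => //; exact: cvg_cst.
have /(_ eventually_filter) headN_small := (cvgr0Pnorm_le _).1 headN _ e3.
near=> N.
have vuM n : `|v n - u N n| <= 2 * M n.
  by rewrite (le_trans (ler_normB _ _))// mulr_natl mulr2n lerD.
have c2M : cvgn (series (fun n => 2 * M n)) by exact: (is_cvg_seriesZ (k := 2) cM).
have cvu : cvgn (series (fun n => `|v n - u N n|)).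
  by apply: series_le_cvg vuM c2M => // n; rewrite mulr_ge0.
rewrite -lim_seriesB; [|exact: (series_dominated_is_cvg _ cM)..].
apply: (le_trans (lim_series_norm _)); first exact: cvu.
have -> : e = e / 3 + 2 * (e / 3) by field.
apply: (@le_trans _ _ (\sum_(0 <= n < m) `|v n - u N n| +
    2 * (limn (series M) - series M m))); last first.
  apply: lerD; last by rewrite ler_pM2l.
  rewrite (le_trans (ler_norm _))//; near: N; exact: headN_small.
apply: limr_le; first exact: cvu.
near=> k; have mk : (m <= k)%N by near: k; exact: nbhs_infty_ge.
rewrite [leLHS]/series /= (big_cat_nat (leq0n m) mk)//= lerD2l.
rewrite (le_trans (ler_sum _ (fun i _ => vuM i)))//.
rewrite -mulr_sumr ler_pM2l// -(sub_series_geq _ mk) lerD2r.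
apply: nondecreasing_cvgn_le => //; exact: nondecreasing_series.
Unshelve. all: by end_near. Qed.

Lemma series_recl (R : realType) (u : R ^nat) : cvgn (series u) ->
  cvgn (series (fun n => u n.+1)) /\
  limn (series (fun n => u n.+1)) = limn (series u) - u 0%N.
Proof.
move=> cu.
have uS : series (fun n => u n.+1) @ \oo --> limn (series u) - u 0%N.
  rewrite (_ : series _ = fun n => series u n.+1 - u 0%N).
    by apply: cvgB; [rewrite cvg_shiftS|exact: cvg_cst].
  by apply/funext => n; rewrite /series /= big_nat_recl// addrC addKr.
by split; [exact/cvgP/uS|exact/cvg_lim].
Qed.

Lemma series_linear (R : realType) (a b : R) (u v : R ^nat) :
  cvgn (series u) -> cvgn (series v) ->
  cvgn (series (fun n => a * u n + b * v n)) /\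
  limn (series (fun n => a * u n + b * v n)) =
    a * limn (series u) + b * limn (series v).
Proof.
move=> cu cv.
have cau := is_cvg_seriesZ (k := a) cu; have cbv := is_cvg_seriesZ (k := b) cv.
split; first exact: is_cvg_seriesD cau cbv.
by rewrite (lim_seriesD cau cbv) !lim_seriesZ.
Qed.

Lemma bisum_dominated_cvg (R : realType) (u : nat -> int -> R) (v M : int -> R) :
  (forall N n, `|u N n| <= M n) -> bisum_cvg M ->
  (forall n, u N n @[N --> \oo] --> v n) ->
  bisum (u N) @[N --> \oo] --> bisum v.
Proof.
move=> uM [cM cM'] uv; apply: cvgD.
  exact: (@series_dominated_cvg _ (fun N n => u N (Posz n)) _ (fun n => M (Posz n))).
exact: (@series_dominated_cvg _ (fun N n => u N (Negz n)) _ (fun n => M (Negz n))).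
Qed.

Lemma bisum_dominated_is_cvg (R : realType) (u M : int -> R) :
  (forall n, `|u n| <= M n) -> bisum_cvg M -> bisum_cvg u.
Proof.
move=> uM [cM cM']; split.
  exact: (@series_dominated_is_cvg _ _ (fun n => M (Posz n))).
exact: (@series_dominated_is_cvg _ _ (fun n => M (Negz n))).
Qed.

Lemma bisum_linear (R : realType) (a b : R) (u v : int -> R) :
  bisum_cvg u -> bisum_cvg v ->
  bisum_cvg (fun n => a * u n + b * v n) /\
  bisum (fun n => a * u n + b * v n) = a * bisum u + b * bisum v.
Proof.
move=> [cu cu'] [cv cv'].
have [cP eP] := series_linear a b cu cv; have [cN eN] := series_linear a b cu' cv'.
by split=> //; rewrite /bisum eP eN; ring.
Qed.

Lemma bisum_shift (R : realType) (u : int -> R) : bisum_cvg u ->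
  bisum (fun n => u (n + 1)) = bisum u.
Proof.
move=> [cu cu']; rewrite /bisum.
have [cP] := series_recl cu.
have -> : (fun n => u (Posz n + 1)) = (fun n => u n.+1) by apply/funext => n; rewrite intS addrC.
move=> ->.
(* The shift moves [u 0] from the nonnegative half to the negative half: [Negz 0 + 1] is 0. *)
have uN : series (fun n => u (Negz n + 1)) @ \oo -->
    limn (series (fun n => u (Negz n))) + u 0.
  rewrite -cvg_shiftS /=.
  rewrite (_ : (fun n => _) = fun n => series (fun n => u (Negz n)) n + u 0).
    by apply: cvgD => //; exact: cvg_cst.
  apply/funext => n; rewrite /series /= big_nat_recl// addrC.
  by congr (_ + _); apply: eq_bigr => i _; congr u; rewrite !NegzE; lia.
by rewrite (cvg_lim _ uN)//; ring.
Qed.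

Lemma bisum_nat (R : realType) (u : int -> R) : (forall n : nat, u (Negz n) = 0) ->
  bisum u = limn (series (fun n : nat => u n)).
Proof.
move=> u0; rewrite /bisum (_ : (fun n => u (Negz n)) = fun=> 0); last exact/funext.
rewrite [series (fun=> 0)](_ : _ = fun=> 0) ?lim_cst ?addr0//.
by apply/funext => n; rewrite /series /= big1.
Qed.

(** * The recurrence in [b] for the two-sided sum, and its iteration *)

(* Up to a constant factor, the terms of Ramanujan's 1psi1 sum of
   (-c; q)_n / (-b; q)_n z^n over all integers n. *)
Definition psi_term (R : realType) (q z c b : R) (n : int) : R :=
  z ^ n * qpow_infty q (q ^ n * b) / qpow_infty q (q ^ n * c).

Lemma exprz_succ (R : realType) (x : R) (n : int) : x != 0 -> x ^ (n + 1) = x * x ^ n.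
Proof. by move=> x0; rewrite expfzDr// expr1z mulrC. Qed.

(** With x = q^n, one step of the product in the denominator brings out 1 + x c = (1 - c/b) + (c/b)
    (1 + x b). The factor 1 + x b then turns P(q x b) back into P(x b). *)
Lemma psi_term_shift (R : realType) (q z c b : R) (n : int) :
  0 < q -> q < 1 -> 0 < z -> 0 < c -> b != 0 ->
  psi_term q z c b (n + 1) =
  (z - z * c / b) * psi_term q z c (q * b) n + z * c / b * psi_term q z c b n.
Proof.
move=> q0 q1 z0 c0 b0; rewrite /psi_term !exprz_succ ?gt_eqF//.
have qn0 : 0 < q ^ n by rewrite exprz_gt0.
have c1 : 0 < 1 + q ^ n * c by rewrite addr_gt0// mulr_gt0.
rewrite (qpow_inftyS (q ^ n * b))// (qpow_inftyS (q ^ n * c))//.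
have -> : q ^ n * (q * b) = q * (q ^ n * b) by ring.
rewrite -!mulrA.
have : 0 < qpow_infty q (q * (q ^ n * c)).
  by rewrite (lt_le_trans ltr01)// qpow_infty_ge1// !mulr_ge0// ltW.
move: (qpow_infty q (q * (q ^ n * c))) (qpow_infty q (q * (q ^ n * b))) => P Q P0.
field.
by rewrite b0 !gt_eqF.
Qed.

(** Sum [psi_term_shift] over all n: the left side is again F(b) by shift invariance, which leaves a
    linear relation between F(b) and F(qb). *)
Lemma bisum_psi_rec (R : realType) (q z c b : R) :
  0 < q -> q < 1 -> 0 < z -> 0 < c ->
  bisum_cvg (psi_term q z c b) -> bisum_cvg (psi_term q z c (q * b)) ->
  (1 - b / (z * c)) * bisum (psi_term q z c b) =
  (1 - b / c) * bisum (psi_term q z c (q * b)).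
Proof.
move=> q0 q1 z0 c0 cb cqb; have [->|b0] := eqVneq b 0; first by rewrite mulr0 !mul0r.
have := bisum_shift cb.
rewrite (_ : (fun n => _) = fun n => (z - z * c / b) * psi_term q z c (q * b) n +
    z * c / b * psi_term q z c b n); last first.
  by apply/funext => n; exact: psi_term_shift.
have [_ ->] := bisum_linear (z - z * c / b) (z * c / b) cqb cb.
move: (bisum (psi_term q z c (q * b))) (bisum (psi_term q z c b)) => F F' FF.
have {}FF : (z * c - b) * F' = z * (c - b) * F.
  apply/eqP; rewrite -subr_eq0.
  have -> : (z * c - b) * F' - z * (c - b) * F =
    b * ((z - z * c / b) * F + z * c / b * F' - F') by field.
  by rewrite FF subrr mulr0.
have -> : (1 - b / (z * c)) * F' = (z * c - b) * F' / (z * c) by field; rewrite !gt_eqF.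
by rewrite FF; field; rewrite !gt_eqF.
Qed.

(* Iterate b -> q b down to b = 0. *)
Lemma bisum_psi_0 (R : realType) (q z c b : R) (M : int -> R) :
  0 < q -> q < 1 -> 0 < z -> 0 < c -> bisum_cvg M ->
  (forall (N : nat) n, `|psi_term q z c (q ^+ N * b) n| <= M n) ->
  qpow_infty q (- (b / (z * c))) * bisum (psi_term q z c b) =
  qpow_infty q (- (b / c)) * bisum (psi_term q z c 0).
Proof.
move=> q0 q1 z0 c0 cM bM.
have iter N : \prod_(0 <= j < N) (1 + q ^+ j * - (b / (z * c))) *
      bisum (psi_term q z c b) =
    \prod_(0 <= j < N) (1 + q ^+ j * - (b / c)) * bisum (psi_term q z c (q ^+ N * b)).
  elim: N => [|N IH]; first by rewrite !big_geq// expr0 !mul1r.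
  (* The majorant [M], uniform in [N], gives the convergence needed at each step here and the
     passage to the limit below. *)
  have cN k : bisum_cvg (psi_term q z c (q ^+ k * b)).
    exact: (bisum_dominated_is_cvg (bM k)).
  rewrite !big_nat_recr//= mulrAC IH -!mulrA; congr (_ * _).
  rewrite mulrC !mulrN (mulrA _ b (z * c)^-1) (mulrA _ b c^-1) exprS -(mulrA q).
  by apply: bisum_psi_rec => //; rewrite mulrA -exprS.
(* Both sides of [iter] are the same sequence in [N]; the goal equates its limit computed in two
   ways. *)
have lhs : (\prod_(0 <= j < N) (1 + q ^+ j * - (b / (z * c))) *
      bisum (psi_term q z c b)) @[N --> \oo] -->
    qpow_infty q (- (b / (z * c))) * bisum (psi_term q z c b).
  by apply: cvgMr_tmp; exact: qprod_cvg.
rewrite -(cvg_lim (@Rhausdorff R) lhs); apply: cvg_lim => //.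
under eq_fun do rewrite iter.
apply: cvgM; first exact: qprod_cvg.
apply: (bisum_dominated_cvg bM cM) => n.
rewrite /psi_term mulr0 qpow_infty0.
apply: cvgMr_tmp; apply: cvgMl_tmp.
under eq_fun do rewrite mulrCA.
exact: qpow_infty_cvg1.
Qed.

(** * Bounds on the terms and convergence of the two-sided sum *)

Lemma psi_term_ge0 (R : realType) (q z c b : R) (n : int) :
  0 < q -> q < 1 -> 0 < z -> 0 < c -> 0 <= b -> 0 <= psi_term q z c b n.
Proof.
move=> q0 q1 z0 c0 b0; have qn0 : 0 < q ^ n by rewrite exprz_gt0.
have P1 x : 0 <= x -> 0 <= qpow_infty q (q ^ n * x).
  by move=> x0; rewrite (le_trans ler01)// qpow_infty_ge1// mulr_ge0// ltW.
by rewrite divr_ge0 ?mulr_ge0 ?P1// ltW// exprz_gt0.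
Qed.

Lemma psi_term_le (R : realType) (q z c b b' : R) (n : int) :
  0 < q -> q < 1 -> 0 < z -> 0 < c -> 0 <= b -> b <= b' ->
  psi_term q z c b n <= psi_term q z c b' n.
Proof.
move=> q0 q1 z0 c0 b0 bb'; have qn0 : 0 < q ^ n by rewrite exprz_gt0.
rewrite ler_pM2r; last first.
  by rewrite invr_gt0 (lt_le_trans ltr01)// qpow_infty_ge1// mulr_ge0// ltW.
rewrite ler_pM2l ?exprz_gt0//; apply: ler_qpow_infty => //; last by rewrite ler_pM2l.
by rewrite (@le_trans _ _ 0)// mulr_ge0// ltW.
Qed.

Lemma psi_term_nat_le (R : realType) (q z c b : R) (n : nat) :
  0 < q -> q < 1 -> 0 < z -> 0 < c -> 0 <= b ->
  psi_term q z c b n <= qpow_infty q b * z ^+ n.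
Proof.
move=> q0 q1 z0 c0 b0; have qn0 : 0 < q ^+ n by rewrite exprn_gt0.
have qnb0 : 0 <= q ^+ n * b by rewrite mulr_ge0// ltW.
have qnc0 : 0 <= q ^+ n * c by rewrite mulr_ge0// ltW.
rewrite /psi_term -!exprnP ler_pdivrMr; last first.
  by rewrite (lt_le_trans ltr01)// qpow_infty_ge1.
rewrite mulrAC mulrC ler_pM2r ?exprn_gt0//.
have Pb0 : 0 <= qpow_infty q b by rewrite (le_trans ler01)// qpow_infty_ge1.
apply: (@le_trans _ _ (qpow_infty q b)); last by rewrite ler_peMr// qpow_infty_ge1.
apply: ler_qpow_infty => //; first by rewrite (@le_trans _ _ 0).
by rewrite ler_piMl// exprn_ile1// ltW.
Qed.

(** With x = q^(n+1), passing from index -n to -(n+1) multiplies the term by (x + b) / (z (x + c)),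
    which is at most (x + b) / (z c) = b/(z c) (1 + x/b). The product of the factors 1 + x/b stays
    bounded, so the decay is geometric with ratio b/(z c). *)
Lemma psi_term_neg_le (R : realType) (q z c b : R) (n : nat) :
  0 < q -> q < 1 -> 0 < z -> 0 < c -> 0 < b ->
  psi_term q z c b (- n%:Z) <=
  psi_term q z c b 0 * ((b / (z * c)) ^+ n * \prod_(0 <= j < n) (1 + q ^+ j * (q / b))).
Proof.
move=> q0 q1 z0 c0 b0; elim: n => [|n IH].
  by rewrite oppr0 big_geq// expr0 !mulr1.
rewrite big_nat_recr//= exprSr.
set r := b / (z * c); set p := \prod_(0 <= j < n) _.
have -> : psi_term q z c b 0 * (r ^+ n * r * (p * (1 + q ^+ n * (q / b)))) =
  psi_term q z c b 0 * (r ^+ n * p) * (r * (1 + q ^+ n * (q / b))) by ring.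
apply: (@le_trans _ _ (psi_term q z c b (- n%:Z) * (r * (1 + q ^+ n * (q / b))))); last first.
  by rewrite ler_wpM2r// mulr_ge0 ?divr_ge0 ?addr_ge0 ?mulr_ge0 ?exprn_ge0// ?invr_ge0 ltW.
have -> : - n%:Z = - n.+1%:Z + 1 by rewrite intS; ring.
move: IH => _; rewrite /psi_term !exprz_succ ?gt_eqF//.
have qm : q ^ (- n.+1%:Z) = (q ^+ n.+1)^-1 by rewrite -exprnN.
have x0 : 0 < q ^+ n.+1 by rewrite exprn_gt0.
have -> : q ^+ n * (q / b) = q ^+ n.+1 / b by rewrite exprSr mulrA.
rewrite (qpow_inftyS (_ * b))// (qpow_inftyS (_ * c))// !mulrA qm.
move: (q ^+ n.+1) x0 => x x0.
have Z0 : 0 < z ^ (- n.+1%:Z) by rewrite exprz_gt0.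
have : 0 < qpow_infty q (q * x^-1 * c).
  by rewrite (lt_le_trans ltr01)// qpow_infty_ge1// !mulr_ge0 ?invr_ge0// ltW.
have : 0 < qpow_infty q (q * x^-1 * b).
  by rewrite (lt_le_trans ltr01)// qpow_infty_ge1// !mulr_ge0 ?invr_ge0// ltW.
move: (qpow_infty q (q * x^-1 * b)) (qpow_infty q (q * x^-1 * c)) (z ^ _) Z0 => B C Z Z0 B0 C0.
have xc : 0 < x + c by rewrite addr_gt0.
have -> : Z * (1 + x^-1 * b) * B / ((1 + x^-1 * c) * C) =
  Z * B / C * ((x + b) / (x + c)).
  by field; rewrite !gt_eqF// addrC.
have -> : z * Z * B / C * b / (z * c) * (1 + x / b) = Z * B / C * ((x + b) / c).
  by field; rewrite !gt_eqF.
rewrite ler_pM2l ?divr_gt0 ?mulr_gt0// ler_pM2l ?addr_gt0//.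
by rewrite lef_pV2 ?posrE// lerDr ltW.
Qed.

(** The nonnegative half is dominated by a geometric series of ratio [z], the negative half by one
    of ratio b/(z c); both ratios are below 1. *)
Lemma bisum_cvg_psi (R : realType) (q z c b : R) :
  0 < q -> q < 1 -> 0 < z -> z < 1 -> 0 < c -> 0 <= b -> b < z * c ->
  bisum_cvg (psi_term q z c b).
Proof.
move=> q0 q1 z0 z1 c0.
wlog b0 : b / 0 < b.
  move=> H; rewrite le_eqVlt => /predU1P[<- _|b0 bzc]; last exact: H (b0) (ltW b0) bzc.
  have b0 : 0 < z * c / 2 by rewrite divr_gt0// mulr_gt0.
  have bzc : z * c / 2 < z * c by rewrite gtr_pMr ?mulr_gt0// invf_lt1// ltr1n.
  apply: bisum_dominated_is_cvg (H _ b0 (ltW b0) bzc) => n.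
  by rewrite ger0_norm ?psi_term_ge0// psi_term_le// ltW.
move=> _ bzc; set r := b / (z * c).
have r0 : 0 < r by rewrite divr_gt0// mulr_gt0.
have r1 : r < 1 by rewrite ltr_pdivrMr ?mul1r// mulr_gt0.
split.
  apply: (@series_dominated_is_cvg _ _ (geometric (qpow_infty q b) z)) => [n|].
    by rewrite ger0_norm ?psi_term_nat_le ?psi_term_ge0// ltW.
  by apply: is_cvg_geometric_series; rewrite ger0_norm// ltW.
set K := psi_term q z c b 0 * expR (q / b / (1 - q)).
apply: (@series_dominated_is_cvg _ _ (geometric (K * r) r)) => [n|]; last first.
  by apply: is_cvg_geometric_series; rewrite ger0_norm// ltW.
rewrite ger0_norm ?psi_term_ge0 ?(ltW b0)// NegzE (le_trans (psi_term_neg_le _ _ _ _ _ _))//.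
rewrite -/r /geometric /= /K.
have -> : psi_term q z c b 0 * expR (q / b / (1 - q)) * r * r ^+ n =
  psi_term q z c b 0 * (r ^+ n.+1 * expR (q / b / (1 - q))) by rewrite exprS; ring.
rewrite ler_wpM2l ?psi_term_ge0 ?(ltW b0)// ler_wpM2l ?exprn_ge0 ?(ltW r0)//.
by apply: qprod_le_expR => //; rewrite divr_ge0// ltW.
Qed.

(** * The one-sided sum at b = -q and its link to the two-sided sum *)

(** The factor of index j = n is 1 - q^n q^(-n) = 0. This is what cuts the two-sided sum down to a
    one-sided one. *)
Lemma qpow_infty_nonpos_exp (R : realType) (q : R) (n : nat) : 0 < q -> q < 1 ->
  qpow_infty q (- q ^ (- n%:Z)) = 0.
Proof.
move=> q0 q1; rewrite (qpow_infty_split _ n.+1 q0 q1) big_nat_recr//=.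
by rewrite -exprnN mulrN divff ?subrr ?mulr0 ?mul0r// expf_neq0// gt_eqF.
Qed.

Lemma qpow_infty_exp_norm_le1 (R : realType) (q : R) (m : int) : 0 < q -> q < 1 ->
  `|qpow_infty q (- q ^ m)| <= 1.
Proof.
move=> q0 q1; case: m => n; last by rewrite NegzE qpow_infty_nonpos_exp// normr0.
have qn1 : -1 <= - q ^ n by rewrite lerN2 -exprnP exprn_ile1// ltW.
rewrite ger0_norm ?qpow_infty_ge0// -[leRHS](qpow_infty0 q) ler_qpow_infty//.
by rewrite oppr_le0 -exprnP exprn_ge0// ltW.
Qed.

(** A bound for the denominators, uniform in [n], that also covers negative [c], since the q-beta
    function has c = -q^s. If c < 0 then q^n c >= c and monotonicity applies. *)
Lemma qpow_infty_geometric_ge (R : realType) (q c : R) (n : nat) :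
  0 < q -> q < 1 -> -1 < c ->
  Num.min 1 (qpow_infty q c) <= qpow_infty q (q ^+ n * c).
Proof.
move=> q0 q1 c1; rewrite ge_min; apply/orP; have [c0|c0] := leP 0 c.
  by left; rewrite qpow_infty_ge1// mulr_ge0// exprn_ge0// ltW.
right; apply: ler_qpow_infty => //; first exact: ltW.
by rewrite -lerN2 -mulrN ler_piMl ?oppr_ge0 ?exprn_ile1// ltW.
Qed.

Lemma psi_term_binom_le (R : realType) (q z c : R) (N n : nat) :
  0 < q -> q < 1 -> 0 < z -> -1 < c ->
  `|psi_term q z (q ^+ N * c) (- q) n| <=
  geometric (Num.min 1 (qpow_infty q c))^-1 z n.
Proof.
move=> q0 q1 z0 c1; rewrite /psi_term /geometric /= -!exprnP mulrA -exprD.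
have K0 : 0 < Num.min 1 (qpow_infty q c) by rewrite lt_min ltr01 qpow_infty_gt0.
have KP := qpow_infty_geometric_ge (n + N) q0 q1 c1.
have P0 := lt_le_trans K0 KP.
have z0' : 0 < z ^+ n by rewrite exprn_gt0.
rewrite 2!normrM normfV (gtr0_norm z0') (gtr0_norm P0) [leRHS]mulrC.
apply: ler_pM; rewrite ?mulr_ge0 ?invr_ge0 ?(ltW z0') ?(ltW P0)//.
  rewrite ler_piMr ?(ltW z0')// mulrN -exprSr.
  exact: (qpow_infty_exp_norm_le1 n.+1).
by rewrite lef_pV2 ?posrE.
Qed.

Lemma cvg_psi_binom (R : realType) (q z c : R) :
  0 < q -> q < 1 -> 0 < z -> z < 1 -> -1 < c ->
  cvgn (series (fun n : nat => psi_term q z c (- q) n)).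
Proof.
move=> q0 q1 z0 z1 c1.
apply: (@series_dominated_is_cvg _ _ (geometric (Num.min 1 (qpow_infty q c))^-1 z)) => [n|].
  by have := psi_term_binom_le 0 n q0 q1 z0 c1; rewrite expr0 mul1r.
by apply: is_cvg_geometric_series; rewrite ger0_norm// ltW.
Qed.

(** Let w(n) be (1 + 1/c) times the term for c, minus 1/c times the term for qc. Then w(0) = 0 and
    w(n+1) is z times the n-th term for qc, so summing gives (1 + 1/c) S(c) - S(qc)/c = z S(qc). *)
Lemma psi_binom_rec (R : realType) (q z c : R) :
  0 < q -> q < 1 -> 0 < z -> z < 1 -> -1 < c ->
  (1 + c) * limn (series (fun n : nat => psi_term q z c (- q) n)) =
  (1 + z * c) * limn (series (fun n : nat => psi_term q z (q * c) (- q) n)).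
Proof.
move=> q0 q1 z0 z1 c1; have [->|c0] := eqVneq c 0; first by rewrite !mulr0.
have qc1 : -1 < q * c by nra.
have cS := cvg_psi_binom q0 q1 z0 z1 c1.
have cS' := cvg_psi_binom q0 q1 z0 z1 qc1.
have [cw lw] := series_linear (1 + c^-1) (- c^-1) cS cS'.
have [_] := series_recl cw; rewrite lw.
have w0 : (1 + c^-1) * psi_term q z c (- q) 0%N -
    c^-1 * psi_term q z (q * c) (- q) 0%N = 0.
  rewrite /psi_term expr0z !mul1r (qpow_inftyS c)//.
  have := qpow_infty_gt0 q0 q1 qc1.
  move: (qpow_infty _ _) => P P0; field; rewrite c0 gt_eqF//=.
  by rewrite gt_eqF//; lra.
rewrite [X in _ = _ - X](_ : _ = 0) ?subr0; last by rewrite /= mulNr.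
have -> : (fun n : nat => (1 + c^-1) * psi_term q z c (- q) n.+1 +
    - c^-1 * psi_term q z (q * c) (- q) n.+1) =
    (fun n : nat => z * psi_term q z (q * c) (- q) n).
  apply/funext => n; rewrite /psi_term -!exprnP.
  have qn0 : 0 < q ^+ n by rewrite exprn_gt0.
  have qn1 : q ^+ n <= 1 by rewrite exprn_ile1// ltW.
  have y0 : 0 < q * q ^+ n by rewrite mulr_gt0.
  have y1 : q * q ^+ n < 1 by rewrite (le_lt_trans _ q1)// ler_piMr// ltW.
  have c2 : 0 < 1 + q * q ^+ n * c by nra.
  rewrite (qpow_inftyS (q ^+ n * - q))// (qpow_inftyS (q ^+ n.+1 * c))//.
  rewrite !exprS.
  have -> : q ^+ n * (q * c) = q * q ^+ n * c by ring.
  have -> : q * q ^+ n * (q * c) = q * (q * q ^+ n * c) by ring.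
  have -> : q * (q ^+ n * - q) = q * q ^+ n * - q by ring.
  rewrite (qpow_inftyS (q * q ^+ n * c))//.
  have : 0 < qpow_infty q (q * (q * q ^+ n * c)).
    apply: qpow_infty_gt0 => //; move: (q * q ^+ n * c) c2 => w w1; nra.
  move: (qpow_infty q (q * (q * q ^+ n * c))) (qpow_infty _ _) => P Q P0.
  by field; rewrite c0 !gt_eqF.
have [_] := series_linear z 0 cS' cS'.
under [in LHS]eq_fun do rewrite mul0r addr0.
move=> ->; rewrite mul0r addr0.
move: (limn _) (limn _) => S S' SS.
have -> : (1 + c) * S = c * ((1 + c^-1) * S + - c^-1 * S') + S' by field.
by rewrite -SS; ring.
Qed.

(* The q-binomial theorem. *)
Lemma psi_binom_0 (R : realType) (q z c : R) :
  0 < q -> q < 1 -> 0 < z -> z < 1 -> -1 < c ->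
  qpow_infty q c * limn (series (fun n : nat => psi_term q z c (- q) n)) =
  qpow_infty q (z * c) * limn (series (fun n : nat => psi_term q z 0 (- q) n)).
Proof.
move=> q0 q1 z0 z1 c1.
have qNc1 N : -1 < q ^+ N * c.
  have : 0 < q ^+ N by rewrite exprn_gt0.
  have : q ^+ N <= 1 by rewrite exprn_ile1// ltW.
  by move: (q ^+ N) => x ? ?; nra.
have iter N : \prod_(0 <= j < N) (1 + q ^+ j * c) *
      limn (series (fun n : nat => psi_term q z c (- q) n)) =
    \prod_(0 <= j < N) (1 + q ^+ j * (z * c)) *
      limn (series (fun n : nat => psi_term q z (q ^+ N * c) (- q) n)).
  elim: N => [|N IH]; first by rewrite !big_geq// expr0 !mul1r.
  rewrite !big_nat_recr//= mulrAC IH -!mulrA; congr (_ * _).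
  by rewrite mulrC psi_binom_rec// exprS mulrCA (mulrA q).
have lhs : (\prod_(0 <= j < N) (1 + q ^+ j * c) *
      limn (series (fun n : nat => psi_term q z c (- q) n))) @[N --> \oo] -->
    qpow_infty q c * limn (series (fun n : nat => psi_term q z c (- q) n)).
  by apply: cvgMr_tmp; exact: qprod_cvg.
rewrite -(cvg_lim (@Rhausdorff R) lhs); apply: cvg_lim => //.
under eq_fun do rewrite iter.
apply: cvgM; first exact: qprod_cvg.
(* The majorant is built from the original [c], hence independent of [N]. *)
apply: (@series_dominated_cvg _ (fun N n => psi_term q z (q ^+ N * c) (- q) n) _
  (geometric (Num.min 1 (qpow_infty q c))^-1 z)) => [N n||n].
- exact: psi_term_binom_le.
- by apply: is_cvg_geometric_series; rewrite ger0_norm// ltW.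
rewrite /psi_term mulr0 qpow_infty0.
apply: cvgMl_tmp.
have cvg1 : qpow_infty q (q ^ n * (q ^+ N * c)) @[N --> \oo] --> (1 : R).
  by under eq_fun do rewrite mulrCA; exact: qpow_infty_cvg1.
by have /(_ eventually_filter) := cvgV (oner_neq0 R) cvg1; exact.
Qed.

(* With theta(x) = P(x) P(q/x), this says theta(c) F(0) = theta(z c) S(0): take
   b = -q in bisum_psi_0, where all terms of negative index vanish, and apply the
   q-binomial theorem to what is left. *)
Lemma bisum_psi_theta (R : realType) (q z c : R) :
  0 < q -> q < 1 -> 0 < z -> z < 1 -> 0 < c ->
  qpow_infty q c * qpow_infty q (q / c) * bisum (psi_term q z c 0) =
  qpow_infty q (z * c) * qpow_infty q (q / (z * c)) *
    limn (series (fun n : nat => psi_term q z 0 (- q) n)).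
Proof.
move=> q0 q1 z0 z1 c0.
have zc0 : 0 < z * c by rewrite mulr_gt0.
have c1 : -1 < c by rewrite (lt_trans _ c0)// ltrN10.
(* Every numerator is P(-q^m) for an integer m, of absolute value at most 1 = P(0), so the series
   for b = 0 is a majorant. *)
have dom (N : nat) n : `|psi_term q z c (q ^+ N * - q) n| <= psi_term q z c 0 n.
  have Pc0 : 0 < qpow_infty q (q ^ n * c).
    by rewrite (lt_le_trans ltr01)// qpow_infty_ge1// mulr_ge0// ltW// exprz_gt0.
  have zn0 : 0 < z ^ n by rewrite exprz_gt0.
  rewrite /psi_term 2!normrM normfV (gtr0_norm zn0) (gtr0_norm Pc0) ler_pM2r ?invr_gt0//.
  rewrite ler_pM2l// mulr0 qpow_infty0.
  have -> : q ^ n * (q ^+ N * - q) = - q ^ (n + N.+1%:Z).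
    by rewrite expfzDr ?gt_eqF// -exprnP exprSr; ring.
  exact: qpow_infty_exp_norm_le1.
have := bisum_psi_0 q0 q1 z0 c0 (bisum_cvg_psi q0 q1 z0 z1 c0 (lexx 0) zc0) dom.
rewrite !mulNr !opprK (@bisum_nat _ (psi_term q z c (- q))); last first.
  (* [Negz n] is -(n + 1), and the factor -q raises the exponent to -n, where the product
     vanishes. *)
  move=> n; rewrite /psi_term NegzE.
  have -> : q ^ (- n.+1%:Z) * - q = - q ^ (- n%:Z).
    have -> : - n%:Z = - n.+1%:Z + 1 by rewrite intS; ring.
    by rewrite exprz_succ ?gt_eqF//; ring.
  by rewrite qpow_infty_nonpos_exp// mulr0 mul0r.
move=> bisumE; rewrite -mulrA -bisumE mulrCA psi_binom_0//; ring.
Qed.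

(** * The Jackson integrals and [qK] in terms of P and [psi_term] *)

Lemma mulr_powRB1 (R : realType) (x t : R) : 0 < x -> x * x `^ (t - 1) = x `^ t.
Proof.
move=> x0; rewrite powRB; last by rewrite (gt_eqF x0) implybT.
by rewrite powRr1 ?ltW// mulrC divfK// gt_eqF.
Qed.

Lemma powR_exprz (R : realType) (q t : R) (n : int) : 0 < q -> (q ^ n) `^ t = (q `^ t) ^ n.
Proof.
by move=> q0; rewrite -[q ^ n]powR_intmul ?ltW// powRAC powR_intmul// powR_ge0.
Qed.

Lemma bisum_scale (R : realType) (a : R) (u : int -> R) : bisum_cvg u ->
  bisum_cvg (fun n => a * u n) /\ bisum (fun n => a * u n) = a * bisum u.
Proof.
move=> cu; have := bisum_linear a 0 cu cu; rewrite mul0r addr0.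
by under eq_fun do rewrite mul0r addr0.
Qed.

(** With c = 1/A, the denominator 1 + A turns P(A) into P(qA) = P(q/c), and q^(1-t) A = q/(q^t c).
    So K is A^t times a quotient of theta functions, matching [bisum_psi_theta]. *)
Lemma qKE (R : realType) (q A t : R) : 0 < q -> q < 1 -> 0 < A ->
  qK q A t = A `^ t * (qpow_infty q A^-1 * qpow_infty q (q / A^-1)) /
    (qpow_infty q (q `^ t * A^-1) * qpow_infty q (q / (q `^ t * A^-1))).
Proof.
move=> q0 q1 A0; rewrite /qK /qpow (qpow_inftyS A)// !invrK.
have z0 : 0 < q `^ t by rewrite powR_gt0.
have -> : q `^ (1 - t) * A = q / (q `^ t * A^-1).
  rewrite powRB; last by rewrite (gt_eqF q0) implybT.
  by rewrite powRr1 ?ltW//; field; rewrite !gt_eqF.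
have : 0 < qpow_infty q (q `^ t * A^-1).
  by rewrite (lt_le_trans ltr01)// qpow_infty_ge1// mulr_ge0 ?invr_ge0 ?ltW.
have : 0 < qpow_infty q (q / (q `^ t * A^-1)).
  by rewrite (lt_le_trans ltr01)// qpow_infty_ge1// divr_ge0 ?mulr_ge0 ?invr_ge0 ?ltW.
move: (qpow_infty q (q `^ t * A^-1)) (qpow_infty q (q / (q `^ t * A^-1))) => P Q Q0 P0.
by field; rewrite !gt_eqF// addr_gt0.
Qed.

Lemma powR_lt1 (R : realType) (x r : R) : 0 < x -> x < 1 -> 0 < r -> x `^ r < 1.
Proof.
move=> x0 x1 r0; suff : x `^ r < 1 `^ r by rewrite powR1.
by apply: gt0_ltr_powR => //; rewrite nnegrE ltW.
Qed.

(** The factor 1 - q in the bound cancels the one in the q-exponential, so the denominator is P(q^n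
    / A). The weight x x^(t-1) = x^t yields z^n with z = q^t. *)
Lemma gamma_termE (R : realType) (q A t : R) : 0 < q -> q < 1 -> 0 < A ->
  jackson_improper_term q (fun x => x `^ (t - 1) * eq_exp q (- x)) (A * (1 - q)) =
  (fun n => (A * (1 - q))^-1 `^ t * psi_term q (q `^ t) A^-1 0 n).
Proof.
move=> q0 q1 A0; have q10 : 0 < 1 - q by rewrite subr_gt0.
apply/funext => n; rewrite /jackson_improper_term /psi_term /eq_exp.
have a0 : 0 < (A * (1 - q))^-1 by rewrite invr_gt0 mulr_gt0.
have qn0 : 0 < q ^ n by rewrite exprz_gt0.
rewrite mulrA mulr_powRB1 ?mulr_gt0// powRM ?ltW// powR_exprz// mulr0 qpow_infty0 mulr1.
have -> : - ((1 - q) * - (q ^ n / (A * (1 - q)))) = q ^ n * A^-1.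
  by field; rewrite !gt_eqF.
by rewrite mulrA [X in X / _]mulrC.
Qed.

Lemma beta_termE (R : realType) (q A t s : R) : 0 < q -> q < 1 -> 0 < A ->
  jackson_improper_term q (fun x => x `^ (t - 1) / qpow q x (t + s)) A =
  (fun n => A^-1 `^ t * psi_term q (q `^ t) A^-1 (q `^ (t + s) / A) n).
Proof.
move=> q0 q1 A0; apply/funext => n; rewrite /jackson_improper_term /psi_term /qpow.
have a0 : 0 < A^-1 by rewrite invr_gt0.
have qn0 : 0 < q ^ n by rewrite exprz_gt0.
rewrite mulrA mulr_powRB1 ?mulr_gt0// powRM ?ltW// powR_exprz// invf_div.
have -> : q `^ (t + s) * (q ^ n / A) = q ^ n * (q `^ (t + s) / A) by ring.
ring.
Qed.

Lemma qGammaE (R : realType) (q t : R) : 0 < q -> q < 1 -> 0 < t ->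
  qGamma q t = (1 - q) * ((1 - q)^-1 `^ t *
    limn (series (fun n : nat => psi_term q (q `^ t) 0 (- q) n))).
Proof.
move=> q0 q1 t0; rewrite /qGamma /jackson; congr (_ * _).
have q10 : 0 < 1 - q by rewrite subr_gt0.
have a0 : 0 < (1 - q)^-1 by rewrite invr_gt0.
have z0 : 0 < q `^ t by rewrite powR_gt0.
have z1 : q `^ t < 1 by exact: powR_lt1.
have cS := cvg_psi_binom q0 q1 z0 z1 (ltrN10 R).
rewrite -[RHS](lim_seriesZ ((1 - q)^-1 `^ t) cS); congr (limn (series _)).
apply/funext => n; rewrite -[RHS]/((1 - q)^-1 `^ t * psi_term q (q `^ t) 0 (- q) n).
rewrite /psi_term /Eq_exp mulr0 qpow_infty0 divr1.
have qn0 : 0 < q ^+ n by rewrite exprn_gt0.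
have powRn : (q ^+ n) `^ t = (q `^ t) ^ n by rewrite exprnP powR_exprz.
rewrite mulrA mulr_powRB1 ?mulr_gt0// powRM ?ltW// powRn.
have -> : (1 - q) * - (q * (q ^+ n / (1 - q))) = q ^+ n * - q by field; rewrite gt_eqF.
by rewrite mulrAC mulrC.
Qed.

(** At x = q^n the factor (1 - qx)_q^(s-1) is P(-q^(n+1)) / P(-q^(n+s)), whence b = -q and c =
    -q^s. *)
Lemma qBetaE (R : realType) (q t s : R) : 0 < q -> q < 1 ->
  qBeta q t s = (1 - q) *
    limn (series (fun n : nat => psi_term q (q `^ t) (- q `^ s) (- q) n)).
Proof.
move=> q0 q1; rewrite /qBeta /jackson; congr (_ * _); congr (limn (series _)).
apply/funext => n; rewrite /psi_term /qpow mulr1.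
have qn0 : 0 < q ^+ n by rewrite exprn_gt0.
have powRn : (q ^+ n) `^ t = (q `^ t) ^ n by rewrite exprnP powR_exprz.
rewrite mulrA mulr_powRB1// powRn mulrA.
have -> : - (q * q ^+ n) = q ^+ n * - q by ring.
suff -> : q `^ (s - 1) * (q ^+ n * - q) = q ^+ n * - q `^ s by [].
by rewrite -(mulr_powRB1 s q0); ring.
Qed.

Theorem theorem4p3 (R : realType) (q : R) (hq0 : 0 < q) (hq1 : q < 1)
    (A t s : R) (hA : 0 < A) (ht : 0 < t) (hs : 0 < s) :
  (jackson_improper_cvg q (fun x => x `^ (t - 1) * eq_exp q (- x)) (A * (1 - q))
   /\ qK q A t *
        jackson_improper q (fun x => x `^ (t - 1) * eq_exp q (- x)) (A * (1 - q))
      = qGamma q t)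
  /\
  (jackson_improper_cvg q (fun x => x `^ (t - 1) / qpow q x (t + s)) A
   /\ qK q A t *
        jackson_improper q (fun x => x `^ (t - 1) / qpow q x (t + s)) A
      = qBeta q t s).
Proof.
have z0 : 0 < q `^ t by rewrite powR_gt0.
have z1 : q `^ t < 1 by exact: powR_lt1.
have w0 : 0 < q `^ s by rewrite powR_gt0.
have w1 : q `^ s < 1 by exact: powR_lt1.
have c0 : 0 < A^-1 by rewrite invr_gt0.
have zc0 : 0 < q `^ t * A^-1 by rewrite mulr_gt0.
have q10 : 0 < 1 - q by rewrite subr_gt0.
have b0 : 0 < q `^ (t + s) / A by rewrite divr_gt0// powR_gt0.
have powD : q `^ (t + s) = q `^ t * q `^ s.
  by rewrite powRD// (gt_eqF hq0) implybT.
(* Here b = q^s z c with q^s < 1, which is the strict bound required for convergence. *)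
have bzc : q `^ (t + s) / A < q `^ t * A^-1 by rewrite powD ltr_pM2r// gtr_pMr.
have cF := bisum_cvg_psi hq0 hq1 z0 z1 c0 (lexx 0) zc0.
have cFb := bisum_cvg_psi hq0 hq1 z0 z1 c0 (ltW b0) bzc.
have AV : A `^ t * A^-1 `^ t = 1.
  by rewrite -powRM ?ltW// mulfV ?powR1// gt_eqF.
have [cG eG] := bisum_scale ((A * (1 - q))^-1 `^ t) cF.
have [cB eB] := bisum_scale (A^-1 `^ t) cFb.
have P0 x : 0 <= x -> qpow_infty q x != 0.
  by move=> x0; rewrite gt_eqF// (lt_le_trans ltr01)// qpow_infty_ge1.
have Pzc := P0 _ (ltW zc0).
have Pqzc : qpow_infty q (q / (q `^ t * A^-1)) != 0 by rewrite P0// divr_ge0// ltW.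
(* The theta identity gives K F(0) = A^t S(0), on which both formulas rest. *)
have KF : qK q A t * bisum (psi_term q (q `^ t) A^-1 0) =
    A `^ t * limn (series (fun n : nat => psi_term q (q `^ t) 0 (- q) n)).
  rewrite qKE// mulrAC -[X in X / _]mulrA bisum_psi_theta// mulrA mulrAC.
  by rewrite [X in X * _]mulrC; field; rewrite Pzc Pqzc.
split.
  rewrite /jackson_improper_cvg /jackson_improper gamma_termE//; split=> //.
  rewrite eG qGammaE// mulrCA [X in _ * X]mulrCA KF; congr (_ * _).
  (* A^t cancels the A-part of (A (1 - q))^(-t), leaving the prefactor of [qGammaE]. *)
  rewrite invfM powRM ?ltW ?invr_gt0// mulrA; congr (_ * _).
  by rewrite mulrAC [A^-1 `^ t * _]mulrC AV mul1r.
rewrite /jackson_improper_cvg /jackson_improper beta_termE//; split=> //.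
rewrite eB qBetaE// mulrCA [X in _ * X]mulrCA; congr (_ * _).
have dom (N : nat) n : `|psi_term q (q `^ t) A^-1 (q ^+ N * (q `^ (t + s) / A)) n| <=
    psi_term q (q `^ t) A^-1 (q `^ (t + s) / A) n.
  have qN0 : 0 <= q ^+ N * (q `^ (t + s) / A) by rewrite mulr_ge0 ?exprn_ge0// ltW.
  rewrite ger0_norm ?psi_term_ge0// psi_term_le//.
  by rewrite ler_piMl ?exprn_ile1// ltW.
have := bisum_psi_0 hq0 hq1 z0 c0 cFb dom.
(* Now P(-q^s) F(b) = P(-q^(t+s)) F(0), while the q-binomial theorem gives P(-q^s) S(-q^s) =
   P(-q^(t+s)) S(0). Since P(-q^s) is nonzero, the beta formula reduces to [KF]. *)
have -> : q `^ (t + s) / A / (q `^ t * A^-1) = q `^ s.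
  by rewrite powD; field; rewrite !gt_eqF.
have -> : q `^ (t + s) / A / A^-1 = q `^ t * q `^ s.
  by rewrite powD; field; rewrite !gt_eqF.
have w1' : -1 < - q `^ s by rewrite ltrN2.
have Pw : qpow_infty q (- q `^ s) != 0 by rewrite gt_eqF// qpow_infty_gt0.
move=> Fb; apply: (mulfI Pw).
rewrite psi_binom_0// mulrN.
rewrite (mulrCA _ (A^-1 `^ t)) (mulrCA _ (qK q A t)) Fb (mulrCA (qK q A t)) KF.
rewrite (mulrCA (A^-1 `^ t)); congr (_ * _).
by rewrite mulrA [A^-1 `^ t * _]mulrC AV mul1r.
Qed.
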